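(* Let $m\ge 3$, $n$ and $t$ be positive integers with $n\ge t-1$ and $t\ge 4$. Then $dyn_t(C_m\Box K_n)=m(t-2)$.
   Context: $C_m$ is the cycle on $m$ vertices and $K_n$ the complete graph on $n$ vertices; $G\Box H$ is the Cartesian product (vertex set $V(G)\times V(H)$, $(u,v)\sim(u',v')$ iff $u=u'$ and $vv'\in E(H)$, or $v=v'$ and $uu'\in E(G)$). For constant threshold $t$, a set $D$ of vertices is a $t$-dynamic monopoly if starting from $D$ and repeatedly adding any vertex having at least $t$ neighbors in the current set eventually yields all vertices; $dyn_t(G)$ is the minimum size of a $t$-dynamic monopoly. *)

(* Defs.v *)
(* A graph is a symmetric irreflexive relation on a finType. *)
From mathcomp Require Import all_boot.

Set Implicit Arguments.
Unset Strict Implicit.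
Unset Printing Implicit Defensive.

(* ordS is the successor modulo m; for m = 1 this has a loop and for m = 2 it
   is a single edge, so it is the cycle graph only when 3 <= m. *)
Definition cycle_graph (m : nat) : rel 'I_m :=
  [rel i j | (j == ordS i) || (i == ordS j)].

Definition complete_graph (n : nat) : rel 'I_n := [rel i j | i != j].

Definition cartesian_product (T U : finType) (G : rel T) (H : rel U) :
    rel (T * U) :=
  [rel p q | (p.1 == q.1) && H p.2 q.2 || (p.2 == q.2) && G p.1 q.1].

Section DynamicMonopoly.

Variables (T : finType) (G : rel T) (t : nat).

Definition neighbors (v : T) : {set T} := [set u | G v u].

Definition activation : rel {set T} :=
  [rel A B | [exists v, (t <= #|neighbors v :&: A|) && (B == v |: A)]].

(* connect is the reflexive transitive closure. *)
Definition dynamic_monopoly (D : {set T}) : bool := connect activation D setT.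

Lemma dynamic_monopoly_setT : dynamic_monopoly setT.
Proof. exact: connect0. Qed.

(* By dynamic_monopoly_setT the minimum ranges over a nonempty family. *)
Definition dyn : nat := #|[arg min_(D < setT | dynamic_monopoly D) #|D|]|.

Lemma dynP :
  (exists2 D, dynamic_monopoly D & #|D| = dyn) /\
  (forall D, dynamic_monopoly D -> dyn <= #|D|).
Proof.
rewrite /dyn; case: arg_minnP => [|D DD Dmin]; first exact: dynamic_monopoly_setT.
by split=> //; exists D.
Qed.

End DynamicMonopoly.

Lemma cycle_graph_sym m : symmetric (@cycle_graph m).
Proof. by move=> i j; rewrite /cycle_graph /= orbC. Qed.

Lemma cycle_graph_irr m : 1 < m -> irreflexive (@cycle_graph m).
Proof.
move=> m1 i; rewrite /cycle_graph /= orbb -val_eqE /=; apply/negbTE; case: i => i im /=.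
have [/eqP e|ne] := boolP (i.+1 == m).
  by rewrite e modnn; apply: contraL m1 => /eqP i0; rewrite -e i0.
have lt_i1m : i.+1 < m by rewrite ltn_neqAle ne.
by rewrite modn_small // neq_ltn leqnn.
Qed.

(* Main.v *)
Require Import Defs.
From mathcomp Require Import all_boot.
From mathcomp Require Import zify.

(** Lower bound: the first vertex activated inside a copy of [K_n] has at most
    two neighbours outside that copy, so every copy contains at least [t - 2]
    vertices of the monopoly.

    Upper bound: put a cyclic interval of [t - 2] columns in each copy, starting
    at column 0 in the first copy, at column 1 in the last one, and alternately
    at columns 2 and 0 in between.  The first copy fills up from its two
    neighbours; then, going round the cycle, each copy has a full predecessor and
    gains one vertex from the successor's interval, after which any vertex of the
    copy has [t] active neighbours. *)

(** * Reachable sets and sets closed under activation *)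

Section Closure.

Variables (T : finType) (G : rel T) (t : nat).

(** Among the sets reachable from [D], one of maximum size is closed, since activating a missing
    vertex would enlarge it. Upper bounds can thus ignore the order of activation. *)
Lemma dynamic_monopoly_closed (D : {set T}) :
  (forall A : {set T}, D \subset A ->
     (forall v, t <= #|neighbors G v :&: A| -> v \in A) -> A = setT) ->
  dynamic_monopoly G t D.
Proof.
move=> closedT; pose P (A : {set T}) := connect (activation G t) D A && (D \subset A).
have PD : P D by rewrite /P connect0 subxx.
case: (arg_maxnP (fun A : {set T} => #|A|) PD) => A /andP[DA sDA] Amax.
rewrite /dynamic_monopoly -(closedT A) // => v tv.
have : P (v |: A).
  rewrite /P (subset_trans sDA (subsetUr _ _)) andbT.
  apply: connect_trans DA (connect1 _).
  by apply/existsP; exists v; rewrite tv eqxx.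
by move/Amax => /=; case: (boolP (v \in A)) => // vA; rewrite cardsU1 vA; lia.
Qed.

Lemma connect_activation_ind (Q : {set T} -> Prop) (D B : {set T}) :
  Q D ->
  (forall A v, Q A -> t <= #|neighbors G v :&: A| -> Q (v |: A)) ->
  connect (activation G t) D B -> Q B.
Proof.
move=> QD Qstep /connectP[p + ->] {B}.
elim: p D QD => //= B p IHp D QD /andP[/existsP[v /andP[tv /eqP->]] pp].
by apply: IHp pp; apply: Qstep.
Qed.

End Closure.

(** * Counting neighbours copy by copy *)

Section Layers.

Variables (m n : nat).
Hypothesis m_ge3 : 3 <= m.

Local Notation G := (cartesian_product (@cycle_graph m) (@complete_graph n)).

Definition layer (A : {set 'I_m * 'I_n}) (i : 'I_m) : {set 'I_n} :=
  [set x | (i, x) \in A].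

Lemma layerS (A B : {set 'I_m * 'I_n}) (i : 'I_m) : A \subset B -> layer A i \subset layer B i.
Proof. by move=> /subsetP sAB; apply/subsetP=> x; rewrite !inE => /sAB. Qed.

Lemma card_layers (A : {set 'I_m * 'I_n}) : #|A| = \sum_i #|layer A i|.
Proof.
under eq_bigr => i _ do rewrite -sum1_card.
by rewrite -sum1_card pair_big_dep /=; apply: eq_bigl => -[i x]; rewrite /= inE.
Qed.

Lemma ordS_neq (i : 'I_m) : ordS i != i.
Proof.
have := cycle_graph_irr (ltnW m_ge3) i.
by rewrite /cycle_graph /= orbb eq_sym => ->.
Qed.

Lemma ord_pred_neq (i : 'I_m) : ord_pred i != i.
Proof. by rewrite -{2}(ord_predK i) eq_sym ordS_neq. Qed.

Lemma ordS_neq_pred (i : 'I_m) : ordS i != ord_pred i.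
Proof.
apply/eqP => /(congr1 (@nat_of_ord m)) /=; have := ltn_ord i; move: (i : nat) => k km.
have [->|k0] := posnP k; first by rewrite !modn_small; lia.
have -> : (k + m).-1 = k.-1 + m by lia.
rewrite modnDr (modn_small (_ : k.-1 < m)); last by lia.
by have [k1|k1] := ltnP k.+1 m; [rewrite modn_small | have -> : k.+1 = m by lia]; rewrite ?modnn; lia.
Qed.

(** The neighbourhood splits into the rest of copy [i] and one vertex in each adjacent copy;
    [3 <= m] makes these three pieces disjoint. *)
Lemma card_neighbors_layer A (i : 'I_m) (x : 'I_n) :
  #|neighbors G (i, x) :&: A| =
  #|layer A i :\ x| + (x \in layer A (ordS i)) + (x \in layer A (ord_pred i)).
Proof.
pose one j := [set p : 'I_m * 'I_n | (p == (j, x)) && (p \in A)].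
have card_one j : #|one j| = (x \in layer A j).
  rewrite inE; case: (boolP ((j, x) \in A)) => jA; last first.
    apply: eq_card0 => p; rewrite !inE; apply/negP => /andP[/eqP->].
    by apply/negP.
  rewrite -[RHS](cards1 (j, x)); apply: eq_card => p; rewrite !inE.
  by case: eqP => // ->.
have -> : neighbors G (i, x) :&: A =
    pair i @: (layer A i :\ x) :|: one (ordS i) :|: one (ord_pred i).
  apply/setP=> -[j y]; rewrite !inE /cartesian_product /cycle_graph /complete_graph /=.
  rewrite !xpair_eqE (eq_sym i j) (eq_sym x y).
  have -> : ((j, y) \in pair i @: (layer A i :\ x)) =
            [&& j == i, y != x & (j, y) \in A].
    apply/imsetP/and3P => [[z] | [/eqP-> yx yA]]; last by exists y; rewrite // !inE yx.
    by rewrite !inE => /andP[zx zA] [-> ->].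
  have -> : (i == ordS j) = (j == ord_pred i).
    by rewrite -(inj_eq (can_inj (@ordSK m)) _ (ord_pred i)) ord_predK eq_sym.
  by do 4![case: (_ == _)]; case: (_ \in A).
have disjU (X Y : {set 'I_m * 'I_n}) : X :&: Y = set0 -> #|X :|: Y| = #|X| + #|Y|.
  by move=> XY0; rewrite cardsU XY0 cards0 subn0.
rewrite !disjU ?card_one ?card_imset //; first by move=> y z [].
  apply/setP=> p; rewrite !inE; apply/negP => /andP[/imsetP[y _ ->]].
  by rewrite xpair_eqE eq_sym (negPf (ordS_neq i)).
apply/setP=> p; rewrite !inE; apply/negP => /andP[pU /andP[/eqP pE _]]; move: pU; rewrite {}pE.
case/orP => [/imsetP[y _ [/eqP]]|]; first by rewrite (negPf (ord_pred_neq i)).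
by rewrite xpair_eqE eq_sym (negPf (ordS_neq_pred i)).
Qed.

Lemma layer_lower_bound t D (i : 'I_m) :
  t - 2 <= n -> dynamic_monopoly G t D -> t - 2 <= #|layer D i|.
Proof.
move=> tn dD; rewrite leqNgt; apply/negP => Dlt.
have : #|layer setT i| < t - 2.
  apply: (connect_activation_ind _ _ t (fun A => #|layer A i| < t - 2) D _ _ _ dD) => //.
  move=> A [j x] /= Alt.
  rewrite card_neighbors_layer => tjx.
  (* If [j = i], fewer than [t - 2] neighbours inside the copy and at most two outside would fall
     short of [t]. So the activated vertex lies in another copy. *)
  suff -> : layer ((j, x) |: A) i = layer A i by [].
  apply/setP=> y; rewrite !inE xpair_eqE; case: eqP => //= ij; exfalso.
  have := subset_leq_card (subsetDl (layer A i) [set x]); move: tjx; rewrite -ij.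
  by do 2![case: (_ \in layer _ _)] => /=; lia.
have -> : layer setT i = setT by apply/setP=> x; rewrite !inE.
by rewrite cardsT card_ord; lia.
Qed.

Section Spreading.

Variables (t : nat) (F : 'I_m -> {set 'I_n}) (A : {set 'I_m * 'I_n}).
Hypothesis cardF : forall i, #|F i| = t - 2.
Hypothesis subFA : forall i, F i \subset layer A i.
Hypothesis t_ge2 : 2 <= t.
Hypothesis closedA : forall v, t <= #|neighbors G v :&: A| -> v \in A.

(** If [x] were inactive, [X] would avoid it and so count entirely among its active neighbours. *)
Lemma layer_closed i (X : {set 'I_n}) x :
  X \subset layer A i ->
  t <= #|X| + (x \in layer A (ordS i)) + (x \in layer A (ord_pred i)) ->
  x \in layer A i.
Proof.
move=> sXA tX; apply: contraT => xA.
move: (xA); rewrite inE => /negP[]; apply: closedA; rewrite card_neighbors_layer; apply: leq_trans tX _.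
rewrite !leq_add2r subset_leq_card // subsetD1 sXA.
by apply: contraNN xA => /(subsetP sXA).
Qed.

(** The vertex [x] reaches [t] from [F i] and its two outer neighbours. The copy then has [t - 1]
    active vertices, and the full predecessor supplies the last neighbour to all others. *)
Lemma layer_full_from_pred i x :
  layer A (ord_pred i) = setT -> x \in layer A (ordS i) -> x \notin F i ->
  layer A i = setT.
Proof.
move=> fullP xS xF.
have xA : x \in layer A i.
  by apply: (layer_closed _ _ _ (subFA i)); rewrite cardF fullP xS in_setT /=; lia.
apply/setP=> y; rewrite [RHS]inE.
apply: (layer_closed _ (x |: F i)); first by rewrite subUset sub1set xA subFA.
by rewrite cardsU1 xF cardF fullP in_setT /=; lia.
Qed.

(** Activating [a] gives [t - 1] active vertices, already the whole copy when [n = t - 1]; no second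
    column outside [F i] exists then, hence the guard on [b]. Otherwise [b] follows with help from
    the successor, and [t] active vertices activate the rest. *)
Lemma layer_full_from_two i a :
  a \in layer A (ordS i) -> a \in layer A (ord_pred i) -> a \notin F i ->
  (t <= n -> exists b, [/\ b \in layer A (ordS i), b \notin F i & b != a]) ->
  t - 1 <= n -> layer A i = setT.
Proof.
move=> aS aP aF bP tn.
have aA : a \in layer A i.
  by apply: (layer_closed _ _ _ (subFA i)); rewrite cardF aS aP /=; lia.
have sub1 : a |: F i \subset layer A i by rewrite subUset sub1set aA subFA.
have card1 : #|a |: F i| = t - 1 by rewrite cardsU1 aF cardF; lia.
have [lt_nt|le_tn] := ltnP n t.
  apply/eqP; rewrite eqEcard subsetT cardsT card_ord.
  by apply: leq_trans (subset_leq_card sub1); rewrite card1; lia.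
have [b [bS bF ba]] := bP le_tn.
have bA : b \in layer A i.
  by apply: (layer_closed _ _ _ sub1); rewrite card1 bS /=; lia.
apply/setP=> y; rewrite [RHS]inE.
apply: (layer_closed _ (b |: (a |: F i))); first by rewrite subUset sub1set bA.
by rewrite cardsU1 card1 !inE (negPf ba) (negPf bF) /=; lia.
Qed.

End Spreading.

End Layers.

(** * Cyclic intervals of columns *)

Section CyclicIntervals.

Variables (n k : nat).
Hypothesis k_lt_n : k < n.

Let mod_lt x : x %% n < n.
Proof. by rewrite ltn_pmod // (leq_ltn_trans _ k_lt_n). Qed.

(** Reduction modulo [n] keeps [k] columns even when [n = k + 1], where the interval from 2 wraps to
    column 0. *)
Definition cyclic_interval (s : nat) : {set 'I_n} :=
  [set Ordinal (mod_lt (s + j)) | j : 'I_k].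

Lemma mem_cyclic_interval s (x : 'I_n) :
  reflect (exists2 j, j < k & (s + j) %% n = x) (x \in cyclic_interval s).
Proof.
apply: (iffP imsetP) => [[j _ ->]|[j jk jx]]; first by exists j.
by exists (Ordinal jk) => //; apply: val_inj.
Qed.

Lemma card_cyclic_interval s : #|cyclic_interval s| = k.
Proof.
rewrite card_imset ?card_ord // => i j /(congr1 val) /= /eqP.
rewrite eqn_modDl !modn_small; try exact: ltn_trans (ltn_ord _) k_lt_n.
by move/eqP/val_inj.
Qed.

Lemma notin_cyclic_interval0 (x : 'I_n) : k <= x -> x \notin cyclic_interval 0.
Proof.
move=> kx; apply/mem_cyclic_interval => -[j jk].
by rewrite add0n modn_small; lia.
Qed.

Lemma in_cyclic_interval s (x : 'I_n) : s <= x < s + k -> x \in cyclic_interval s.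
Proof.
move=> sx; apply/mem_cyclic_interval; exists (x - s); first by lia.
by rewrite subnKC ?modn_small //; lia.
Qed.

(** Column [k] separates start 0 from starts 1 and 2. Column 1 separates 1 from 2: wrapping around
    to it takes offset [n - 1], which is at least [k]. *)
Lemma cyclic_interval_neq r s : 1 < k -> r < s <= 2 -> cyclic_interval r <> cyclic_interval s.
Proof.
move=> k1 rs E.
have [r0|r1] := posnP r.
  have := notin_cyclic_interval0 (Ordinal k_lt_n) (leqnn k).
  by rewrite -r0 E in_cyclic_interval //=; lia.
have n1 : 1 < n by lia.
have : Ordinal n1 \in cyclic_interval r by rewrite in_cyclic_interval //=; lia.
rewrite E => /mem_cyclic_interval[j jk] /=.
have -> : s = 2 by lia.
have [lt_n|ge_n] := ltnP (2 + j) n; first by rewrite modn_small; lia.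
by have -> : 2 + j = n by [lia]; rewrite modnn.
Qed.

End CyclicIntervals.

(** The value 1 at the end differs from both alternating values, so the parity of [m] does not
    matter. *)
Definition interval_start (m i : nat) : nat :=
  if i == 0 then 0 else if i == m.-1 then 1 else if odd i then 2 else 0.

Lemma interval_start_le2 m i : interval_start m i <= 2.
Proof. by rewrite /interval_start; do 3![case: ifP => // _]. Qed.

Lemma interval_startS_neq m i : 3 <= m -> i.+1 < m ->
  interval_start m i.+1 != interval_start m i.
Proof.
rewrite /interval_start => m3 im; case: (i =P 0) => [->|i0] /=.
  by case: ifP.
by case: (i =P m.-1) => [|_]; [lia | case: ifP; case: (odd i)].
Qed.

Theorem theorem8 (m n t : nat) (hm : 3 <= m) (hn : 0 < n) (hnt : t - 1 <= n)
    (ht : 4 <= t) :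
  dyn (cartesian_product (@cycle_graph m) (@complete_graph n)) t = m * (t - 2).
Proof.
have [[D0 D0mon D0card] dyn_le] :=
  dynP (cartesian_product (@cycle_graph m) (@complete_graph n)) t.
apply/eqP; rewrite eqn_leq; apply/andP; split; last first.
  rewrite -D0card card_layers -[m in m * _]card_ord -sum_nat_const.
  by apply: leq_sum => i _; apply: layer_lower_bound => //; lia.
have kn : t - 2 < n by lia.
pose F (i : 'I_m) := cyclic_interval n (t - 2) kn (interval_start m i).
pose D := [set p | p.2 \in F p.1].
have layerD i : layer m n D i = F i by apply/setP=> x; rewrite !inE.
have cardF i : #|F i| = t - 2 by exact: card_cyclic_interval.
suff Dmon : dynamic_monopoly (cartesian_product (@cycle_graph m) (@complete_graph n)) t D.
  apply: leq_trans (dyn_le _ Dmon) _; rewrite card_layers.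
  under eq_bigr => i _ do rewrite layerD cardF.
  by rewrite sum_nat_const card_ord.
apply: dynamic_monopoly_closed => A sDA closedA.
have subFA i : F i \subset layer m n A i by rewrite -layerD layerS.
have ordSE (i : 'I_m) : i.+1 < m -> ordS i = i.+1 :> nat by move=> im /=; rewrite modn_small.
have m0 : 0 < m by lia.
pose i0 := Ordinal m0.
have full0 : layer m n A i0 = setT.
  have startS : interval_start m (ordS i0) = 2.
    by rewrite ordSE /interval_start /=; [case: eqP => //|]; lia.
  have startP : interval_start m (ord_pred i0) = 1.
    rewrite /= add0n modn_small /interval_start ?eqxx; last by lia.
    by case: eqP => //; lia.
  have inS x : 2 <= nat_of_ord x < t -> x \in layer m n A (ordS i0).
    move=> xt; apply: (subsetP (subFA _)); rewrite /F startS.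
    by apply: in_cyclic_interval; lia.
  (* Column [t - 2] is the first one after the interval of copy 0; it lies in both neighbouring
     intervals because [4 <= t]. *)
  apply: (@layer_full_from_two m n hm t F A cardF subFA _ closedA i0 (Ordinal kn)) => //; try lia.
  - by apply: inS => /=; lia.
  - apply: (subsetP (subFA _)); rewrite /F startP.
    by apply: in_cyclic_interval => /=; lia.
  - exact: notin_cyclic_interval0.
  (* The second column is [t - 1], the last of the interval starting at 2. *)
  - move=> le_tn; have t1 : t.-1 < n by lia.
    exists (Ordinal t1); split; first by apply: inS => /=; lia.
      by apply: notin_cyclic_interval0 => /=; lia.
    by rewrite -val_eqE /=; apply/eqP; lia.
have full j (jm : j < m) : layer m n A (Ordinal jm) = setT.
  elim: j jm => [|j IHj] jm; first by rewrite -full0; congr layer; apply: val_inj.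
  have jm' : j < m by lia.
  have predE : ord_pred (Ordinal jm) = Ordinal jm'.
    rewrite -(ordSK (Ordinal jm')); congr ord_pred; apply: val_inj.
    exact/esym/ordSE.
  have [x xS xF] : exists2 x, x \in layer m n A (ordS (Ordinal jm)) & x \notin F (Ordinal jm).
    (* The successor's layer is not contained in [F]: for the last copy it is the full first copy,
       too large; otherwise containment would equate two intervals of equal size with different
       starts. *)
    apply/subsetPn; apply/negP; have [jlt|jge] := ltnP j.+2 m; last first.
      have -> : ordS (Ordinal jm) = i0.
        by apply: val_inj; rewrite /= (_ : j.+2 = m) ?modnn //; lia.
      by rewrite full0 => /subset_leq_card; rewrite cardF cardsT card_ord; lia.
    move=> sub; have /eqP : F (ordS (Ordinal jm)) == F (Ordinal jm).
      by rewrite eqEcard !cardF leqnn (subset_trans (subFA _) sub).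
    rewrite /F ordSE //=; have := interval_startS_neq m j.+1 hm jlt.
    have := interval_start_le2 m j.+2; have := interval_start_le2 m j.+1.
    move=> le1 le2; rewrite neq_ltn => /orP[] lt12; last move/esym.
      by apply: cyclic_interval_neq; lia.
    by apply: cyclic_interval_neq; lia.
  apply: (@layer_full_from_pred m n hm t F A cardF subFA _ closedA _ x) => //; try lia.
  by rewrite predE.
apply/setP=> -[[j jm] x]; rewrite inE.
by have /setP/(_ x) := full j jm; rewrite !inE.
Qed.
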